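(* Let $J\subset\mathbb{R}$ be an interval with left endpoint $0\in J$, let $\mathcal{T}:J\to\mathbb{R}^{2\times2}$ be continuous with $\mathcal{T}(\lambda)$ symmetric for all $\lambda$, and let $\mathcal{D}:J\to\mathbb{R}^{2\times 2}$ be the solution of $\ddot{\mathcal{D}}=\mathcal{T}\mathcal{D}$, $\mathcal{D}(0)=0$, $\dot{\mathcal{D}}(0)=I$. Let $\lambda_c\in J$, $\lambda_c>0$, be a conjugate point, i.e. $\det\mathcal{D}(\lambda_c)=0$. Then an eigenvector of $\mathcal{D}(\lambda_c)$ belonging to the eigenvalue zero cannot be an eigenvector of $\dot{\mathcal{D}}(\lambda_c)$ belonging to the eigenvalue zero: if $x\neq0$ and $\mathcal{D}(\lambda_c)x=0$, then $\dot{\mathcal{D}}(\lambda_c)x\neq0$. In particular, if $\lambda_c$ is a focus (i.e. $\mathcal{D}(\lambda_c)=0$), then $\dot{\mathcal{D}}(\lambda_c)$ has rank $2$; and if $\lambda_c$ is a non-degenerate conjugate point (i.e. $\mathcal{D}(\lambda_c)$ has rank $1$), then $\dot{\mathcal{D}}(\lambda_c)$ has rank at least $1$.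
   Context: Dots denote derivatives with respect to the real (affine) parameter $\lambda$. $\mathcal{T}$ is the optical tidal matrix along a light ray and $\mathcal{D}$ the Jacobi map of the infinitesimal light beam with vertex at $\lambda=0$; $I$ is the $2\times2$ identity matrix. *)

(* Defs.v *)
From HB Require Import structures.
From mathcomp Require Import all_boot all_order all_algebra.
From mathcomp Require Import all_classical all_reals all_analysis.

Set Implicit Arguments.
Unset Strict Implicit.
Unset Printing Implicit Defensive.

Import Order.TTheory GRing.Theory Num.Theory.
Import numFieldNormedType.Exports.

Local Open Scope classical_set_scope.
Local Open Scope ring_scope.

(* [l] is the derivative at [x] of [f] regarded as a function on [J]: the limit
   of the difference quotients is taken along the points [y != x] of [J], so it
   is one-sided at an endpoint of [J] and ignores the values of [f] outside [J].
   At every point of a nondegenerate interval [J] such an [l] is unique. *)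
Definition has_derivative_within (R : realType) (V : normedModType R)
    (J : set R) (f : R -> V) (x : R) (l : V) : Prop :=
  (y - x)^-1 *: (f y - f x) @[y --> within J (x^')] --> l.

(* [Ddot] is the derivative of [D] on [J]; it is a separate argument because it
   is determined by [D] only on [J]. *)
Definition jacobi_solution (R : realType) (J : set R)
    (T D Ddot : R -> 'M[R]_2) : Prop :=
  [/\ forall s, J s -> has_derivative_within J D s (Ddot s),
      forall s, J s -> has_derivative_within J Ddot s (T s *m D s),
      D 0 = 0
    & Ddot 0 = 1%:M].

(* Eigenvectors for the action of matrices on column vectors; the library's
   [eigenspace] is about row vectors. *)
Definition eigenvector (R : realType) (n : nat) (A : 'M[R]_n) (a : R)
    (x : 'cV[R]_n) : Prop :=
  x != 0 /\ A *m x = a *: x.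

(* Main.v *)
Require Import Defs.
From HB Require Import structures.
From mathcomp Require Import all_boot all_order all_algebra.
From mathcomp Require Import all_classical all_reals all_analysis.
From mathcomp Require Import ring lra.
Import Order.TTheory GRing.Theory Num.Theory.
Import numFieldNormedType.Exports.
Local Open Scope classical_set_scope.
Local Open Scope ring_scope.

(* A common null vector x of D and its derivative at lc would make y = D x a
   solution of the linear equation y'' = T y with vanishing Cauchy data at lc.
   The energy E = |y|^2 + |y'|^2 satisfies E' >= - K E for a constant K, because
   T is bounded on [0, lc]; hence e^(K t) E is nondecreasing, and E(lc) = 0
   forces E(0) = |x|^2 = 0. *)

Set Implicit Arguments.
Unset Strict Implicit.
Unset Printing Implicit Defensive.

(** Linearity moves [L] through the difference quotient, continuity through the limit. This is how
    the matrix equation is reduced to scalar ones. *)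
Lemma has_derivative_within_linear (R : realType) (V W : normedModType R)
    (J : set R) (L : {linear V -> W}) (f : R -> V) (s : R) (l : V) :
  continuous L -> has_derivative_within J f s l ->
  has_derivative_within J (L \o f) s (L l).
Proof.
move=> contL fl; rewrite /has_derivative_within.
under eq_fun do rewrite /= -linearB -linearZ.
by apply: (cvg_comp _ _ fl); exact: contL.
Qed.

(** For [y != s], [f y] equals [f s] plus [y - s] times the difference quotient, and the second term
    tends to [0 *: l]. *)
Lemma has_derivative_within_cvg (R : realType) (V : normedModType R)
    (J : set R) (f : R -> V) (s : R) (l : V) :
  has_derivative_within J f s l -> f y @[y --> within J (nbhs s)] --> f s.
Proof.
move=> fl.
have punct : f y @[y --> within J s^'] --> f s.
  have ids : (y - s) @[y --> within J s^'] --> (0 : R).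
    rewrite -[X in _ --> X](subrr s); apply: cvgB; last exact: cvg_cst.
    by apply: cvg_within_filter; apply: cvg_within_filter; exact: cvg_id.
  have : f s + (y - s) *: ((y - s)^-1 *: (f y - f s)) @[y --> within J s^']
      --> f s + 0 *: l.
    by apply: cvgD; [exact: cvg_cst|exact: cvgZ].
  rewrite scale0r addr0; apply: cvg_trans; apply: near_eq_cvg.
  apply: (@filterE _ (nbhs s)) => y ys _ /=.
  by rewrite scalerA divff ?scale1r ?subr_eq0// addrC subrK.
(* The filter in the conclusion also sees [y = s], where [f s] lies in [P] trivially. *)
move=> P Pfs; apply: (@filterS _ (nbhs s) _ _ _ _ (punct P Pfs)) => y Py Jy /=.
have [->|ys] := eqVneq y s; first exact: nbhs_singleton.
exact: Py.
Qed.

(** Near an interior point of [J] the restriction to [J] is void, and the substitution [y = h + s]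
    turns one quotient into the other. *)
Lemma has_derivative_within_is_derive (R : realType) (V : normedModType R)
    (J : set R) (f : R -> V) (s : R) (l : V) :
  nbhs s J -> has_derivative_within J f s l -> is_derive s 1 f l.
Proof.
move=> Js fl.
have quot : h^-1 *: (f (h *: 1 + s) - f s) @[h --> 0^'] --> l.
  move=> P /fl nP.
  have shift0 : (h + s) @[h --> nbhs (0 : R)] --> s.
    rewrite -[X in _ --> X]add0r.
    by apply: cvgD; [exact: cvg_id|exact: cvg_cst].
  have near0 : nbhs (0 : R) (fun h => J (h + s) /\ (h + s != s -> J (h + s) ->
      P ((h + s - s)^-1 *: (f (h + s) - f s)))).
    exact: (shift0 _ (@filterI _ (nbhs s) _ _ _ Js nP)).
  apply: (@filterS _ (nbhs (0 : R)) _ _ _ _ near0) => h [Jh Ph] h0 /=.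
  by move: Ph; rewrite -subr_eq0 addrK [h *: 1]mulr1; apply.
by apply: DeriveDef; [apply/cvg_ex; exists l|exact: cvg_lim].
Qed.

(** Integrating factor: [expR (k * t) * f t] has a nonnegative derivative, so its value at [a] is at
    most its value at [b], which is zero. *)
Lemma nonneg_eq0_left (R : realType) (f df : R -> R) (k a b : R) :
  a <= b -> (forall t, t \in `]a, b[ -> is_derive t 1 f (df t)) ->
  {within `[a, b], continuous f} ->
  (forall t, t \in `]a, b[ -> 0 <= df t + k * f t) ->
  0 <= f a -> f b = 0 -> f a = 0.
Proof.
move=> ab fd fc dfk fa0 fb0.
pose g t := expR (k * t) * f t.
have gd t : t \in `]a, b[ -> is_derive t 1 g (expR (k * t) * (df t + k * f t)).
  move=> tab; have := fd t tab => ft.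
  have ke : is_derive t 1 (fun t => expR (k * t)) (expR (k * t) * k).
    apply: (@is_derive1_comp _ expR ( *%R k)).
    by rewrite -[X in is_derive _ _ _ X]mulr1; exact: is_deriveZ.
  apply: is_derive_eq; rewrite /GRing.scale /=; ring.
have gc : {within `[a, b], continuous g}.
  move=> t; apply: cvgM; last exact: fc.
  apply: (@continuous_subspaceT _ _ _ (fun t => expR (k * t))) => {}t.
  apply: continuous_comp; last exact: continuous_expR.
  exact: mulrl_continuous.
have : g a <= g b.
  apply: (@ger0_derive1_ndecr _ g a b) => // t tab.
    by have := gd t tab => -[].
  rewrite derive1E; have gt := gd t tab; rewrite derive_val.
  by rewrite mulr_ge0 ?expR_ge0 ?dfk.
rewrite /g fb0 mulr0 pmulr_rle0 ?expR_gt0// => fa0'.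
by apply/eqP; rewrite eq_le fa0 fa0'.
Qed.

Lemma within_continuous_mx_bounded (R : realType) (m n : nat)
    (T : R -> 'M[R]_(m, n)) (a b : R) :
  {within `[a, b], continuous T} ->
  exists M : R, forall t i j, t \in `[a, b] -> `|T t i j| <= M.
Proof.
move=> Tc.
have /compact_bounded [M [_ TM]] := continuous_compact Tc (@segment_compact R a b).
(* Boundedness provides a norm bound by every number strictly above [M]; the matrix norm is the
   maximum of the absolute values of the entries. *)
exists (M + 1) => t i j tab.
have /TM : M < M + 1 by rewrite ltrDl.
move=> /(_ (T t)) /= => /(_ (ex_intro2 _ _ t tab erefl)); apply: le_trans.
rewrite [leRHS]mx_normrE.
exact: (@le_bigmax_cond _ _ _ _ (i, j) _ (fun ij => `|T t ij.1 ij.2|)).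
Qed.

Lemma second_order_linear_eq0 (R : realType) (n : nat) (J : set R)
    (T : R -> 'M[R]_n) (u v : 'I_n -> R -> R) (a b : R) :
  a <= b -> `[a, b] `<=` J -> {within J, continuous T} ->
  (forall i s, J s -> has_derivative_within J (u i) s (v i s)) ->
  (forall i s, J s ->
     has_derivative_within J (v i) s (\sum_j T s i j * u j s)) ->
  (forall i, u i b = 0) -> (forall i, v i b = 0) ->
  forall i, u i a = 0 /\ v i a = 0.
Proof.
move=> ab abJ Tc du dv ub vb.
have [M TM] := within_continuous_mx_bounded (continuous_subspaceW abJ Tc).
pose E t := \sum_i (u i t ^+ 2 + v i t ^+ 2).
pose dE t := \sum_i (2 * u i t * v i t + 2 * v i t * \sum_j T t i j * u j t).
(* At the ends of the segment only continuity relative to [[a, b]] is needed; it is inherited from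
   continuity relative to [J]. *)
have contJ (f df : R -> R) : (forall s, J s -> has_derivative_within J f s (df s)) ->
    forall s, s \in `[a, b] -> f x @[x --> within `[a, b] (nbhs s)] --> f s.
  move=> fd; apply/subspace_continuousP.
  apply: (continuous_subspaceW abJ); apply/subspace_continuousP.
  by move=> s Js; apply: has_derivative_within_cvg (fd s Js).
have Ec : {within `[a, b], continuous E}.
  apply/subspace_continuousP => s sab; rewrite /E.
  apply: (@cvg_big _ _ (fun x y : R => x + y)); first exact: add_continuous.
  move=> i _; have ui := contJ _ _ (du i) s sab.
  by have vi := contJ _ _ (dv i) s sab; apply: cvgD; apply: cvgM.
have Ed t : t \in `]a, b[ -> is_derive t 1 E (dE t).
  move=> tab.
  have Jt : J t by apply: abJ; exact: subset_itv_oo_cc.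
  have nJ : nbhs t J.
    apply: filterS (near_in_itvoo tab) => s sab; apply: abJ.
    exact: subset_itv_oo_cc.
  have -> : E = \sum_i (u i ^+ 2 + v i ^+ 2).
    by apply/funext => s; rewrite fct_sumE.
  apply: is_derive_sum => i.
  have ui := has_derivative_within_is_derive nJ (du i t Jt).
  have vi := has_derivative_within_is_derive nJ (dv i t Jt).
  by apply: is_derive_eq; rewrite /GRing.scale /= !expr1.
have E_ge0 t i : 0 <= u i t ^+ 2 + v i t ^+ 2 by rewrite addr_ge0 ?sqr_ge0.
(* The [1] absorbs the terms [2 u_i v_i]. Each term [2 v_i T_ij u_j] is at least
   [- M (v_i^2 + u_j^2)]; in the double sum every square occurs [n] times, whence [n%:R * M]. *)
have dEE t : t \in `]a, b[ -> 0 <= dE t + (1 + n%:R * M) * E t.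
  move=> tab; have tab' : t \in `[a, b] by exact: subset_itv_oo_cc.
  have ME : n%:R * M * E t = \sum_i \sum_j M * (v i t ^+ 2 + u j t ^+ 2).
    rewrite /E big_split /=.
    under [RHS]eq_bigr do
      rewrite -mulr_sumr big_split /= sumr_const card_ord -mulr_natl.
    rewrite -mulr_sumr big_split /= sumr_const card_ord -mulr_sumr -mulr_natl.
    ring.
  rewrite mulrDl mul1r addrA ME /dE /E -!big_split /=; apply: sumr_ge0 => i _.
  have sq : 0 <= (u i t + v i t) ^+ 2 by exact: sqr_ge0.
  have : 0 <= \sum_j (2 * v i t * (T t i j * u j t) +
                      M * (v i t ^+ 2 + u j t ^+ 2)).
    apply: sumr_ge0 => j _.
    (* 2 T u v + M (u^2 + v^2)
       = (M + T) / 2 (u + v)^2 + (M - T) / 2 (u - v)^2 *)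
    have := TM t i j tab'; rewrite ler_norml => /andP[TM1 TM2].
    have p : 0 <= (M + T t i j) * (v i t + u j t) ^+ 2.
      by rewrite mulr_ge0 ?sqr_ge0//; lra.
    have q : 0 <= (M - T t i j) * (v i t - u j t) ^+ 2.
      by rewrite mulr_ge0 ?sqr_ge0//; lra.
    nra.
  rewrite big_split /= -mulr_sumr.
  set S1 := \sum_j _; set S2 := \sum_j _; nra.
have Ea : E a = 0.
  apply: (nonneg_eq0_left ab Ed Ec dEE); first exact: sumr_ge0.
  by rewrite /E big1 // => i _; rewrite ub vb expr0n addr0.
move=> i; have /eqP := Ea; rewrite psumr_eq0 // => /allP /(_ i).
rewrite mem_index_enum => /(_ isT) /=; rewrite paddr_eq0 ?sqr_ge0 // !sqrf_eq0.
by move=> /andP[/eqP -> /eqP ->].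
Qed.

(** [kermx] deals with row vectors, so the criterion is read off from the transpose, which has the
    same rank. *)
Lemma mxrank_full_cVP (F : fieldType) (n : nat) (A : 'M[F]_n) :
  reflect (forall x : 'cV_n, A *m x = 0 -> x = 0) (\rank A == n).
Proof.
rewrite -mxrank_tr -[_ == n]/(row_free _) -kermx_eq0.
apply: (iffP rowV0P) => [ker0 x Ax0|inj v /sub_kermxP vA0].
  apply: trmx_inj; rewrite trmx0; apply: ker0; apply/sub_kermxP.
  by rewrite -trmx_mul Ax0 trmx0.
apply: trmx_inj; rewrite trmx0; apply: inj.
by apply: trmx_inj; rewrite trmx_mul trmxK vA0 trmx0.
Qed.

(** The entries of [D t *m x] and [Ddot t *m x] solve the scalar system with zero data at [s], hence
    also at [0], where [Ddot 0 *m x] is [x] itself. *)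
Lemma jacobi_solution_mulmx_eq0 (R : realType) (J : set R)
    (T D Ddot : R -> 'M[R]_2) (s : R) (x : 'cV[R]_2) :
  is_interval J -> J 0 -> J s -> 0 <= s -> {within J, continuous T} ->
  jacobi_solution J T D Ddot -> D s *m x = 0 -> Ddot s *m x = 0 -> x = 0.
Proof.
move=> Jitv J0 Js s_ge0 Tc [dD dDdot _ Ddot0] Dx Ddotx.
have sub : `[0, s] `<=` J by move=> t /=; rewrite in_itv /= => /(Jitv 0 s J0 Js).
(* The type [R^o] views the scalars as a normed module over themselves, so that [L i] can be a
   linear map between normed modules. *)
pose L i (A : 'M[R]_2) : R^o := (A *m x) i 0.
have linL i : linear (L i).
  by move=> k A B; rewrite /L mulmxDl -scalemxAl !mxE.
have contL i : continuous (L i).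
  move=> A; have -> : L i = fun B => \sum_j B i j * x j 0.
    by apply/funext => B; rewrite /L mxE.
  apply: (@cvg_big _ _ (fun y z : R => y + z) 0 xpredT _ _ (nbhs A)).
    exact: add_continuous.
  move=> j _; apply: (@cvgM _ _ (nbhs A)); last exact: cvg_cst.
  exact: coord_continuous.
have dL i (f : R -> 'M[R]_2) t l : has_derivative_within J f t l ->
    has_derivative_within J (fun t => L i (f t)) t (L i l).
  pose LL := GRing.isLinear.Build _ _ _ _ (L i) (linL i).
  pose L' : {linear 'M[R]_2 -> R^o} := HB.pack (L i) LL.
  exact: (@has_derivative_within_linear _ _ _ J L' f t l (contL i)).
have /(_ _)/= uv0 := @second_order_linear_eq0 R 2 J T (fun i t => L i (D t))
  (fun i t => L i (Ddot t)) 0 s s_ge0 sub Tc (fun i t Jt => dL i _ _ _ (dD t Jt)).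
apply/matrixP => i j; rewrite ord1 [RHS]mxE.
have [] := uv0 _ _ _ i.
- move=> {}i t Jt; have := dL i _ _ _ (dDdot t Jt).
  by rewrite {2}/L -mulmxA mxE.
- by move=> k; rewrite /L Dx mxE.
- by move=> k; rewrite /L Ddotx mxE.
by rewrite /L Ddot0 mul1mx.
Qed.

Theorem mainTheorem1 (R : realType) (J : set R) (T D Ddot : R -> 'M[R]_2)
    (lc : R)
    (J_itv : is_interval J)
    (J0 : J 0)
    (J_ge0 : forall s, J s -> 0 <= s)
    (T_cont : {within J, continuous T})
    (T_sym : forall s, J s -> (T s)^T = T s)
    (D_sol : jacobi_solution J T D Ddot)
    (J_lc : J lc)
    (lc_gt0 : 0 < lc)
    (lc_conj : \det (D lc) = 0) :
  [/\ forall x : 'cV[R]_2, eigenvector (D lc) 0 x -> ~ eigenvector (Ddot lc) 0 x,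
      forall x : 'cV[R]_2, x != 0 -> D lc *m x = 0 -> Ddot lc *m x != 0,
      D lc = 0 -> \rank (Ddot lc) = 2%N
    & \rank (D lc) = 1%N -> (1 <= \rank (Ddot lc))%N].
Proof.
(* The kernels of [D lc] and [Ddot lc] meet only in zero; all four claims follow from this by linear
   algebra. *)
have inj (x : 'cV[R]_2) : D lc *m x = 0 -> Ddot lc *m x = 0 -> x = 0.
  exact: (jacobi_solution_mulmx_eq0 J_itv J0 J_lc (ltW lc_gt0) T_cont D_sol).
split.
- move=> x [/eqP x0 Dx] [_ Ddotx]; apply: x0; apply: inj.
    by rewrite Dx scale0r.
  by rewrite Ddotx scale0r.
- by move=> x /eqP x0 Dx; apply/eqP => /(inj x Dx).
- by move=> D0; apply/eqP/mxrank_full_cVP => x; apply: inj; rewrite D0 mul0mx.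
(* If [Ddot lc] vanished, [D lc] would have trivial kernel and hence rank 2. *)
- move=> rk1; rewrite lt0n mxrank_eq0; apply/eqP => Ddot0.
  have : \rank (D lc) == 2%N.
    by apply/mxrank_full_cVP => x /inj; apply; rewrite Ddot0 mul0mx.
  by rewrite rk1.
Qed.
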